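(* Let $n\geq 1$. Let $c_2(n)$ be the number of partitions of $n$ in which one part occurs exactly twice and all other parts occur exactly once. For a partition $\lambda$ of $n$ into odd parts and a part $i$ of $\lambda$ with multiplicity $m_i\ge1$, let $bomm_\lambda(i)=\lfloor\log_2 m_i\rfloor+1$ be the number of binary digits of $m_i$. Let $b_2(n)$ be the difference $$\sum_{\lambda}\ \sum_{i \text{ a distinct part of } \lambda} bomm_\lambda(i)\;-\;\sum_{\mu}\ell(\mu),$$ where the first sum runs over all partitions $\lambda$ of $n$ into odd parts, the second over all partitions $\mu$ of $n$ into distinct parts, and $\ell(\mu)$ is the number of parts of $\mu$. Then $c_2(n)=b_2(n)$.
   Context: A partition of $n$ is a non-increasing sequence of positive integers (its parts) summing to $n$. *)

(* Defs.v *)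
From HB Require Import structures.
From mathcomp Require Import all_boot all_order all_algebra.

Set Implicit Arguments.
Unset Strict Implicit.
Unset Printing Implicit Defensive.

Import GRing.Theory.

Definition is_partition (n : nat) (s : seq nat) : bool :=
  [&& sorted geq s, all (leq 1) s & sumn s == n].

Record partition_of (n : nat) : Type := PartitionOf {
  parts :> seq nat;
  partsP : is_partition n parts
}.

HB.instance Definition _ n := [isSub for @parts n].
HB.instance Definition _ n := [Countable of partition_of n by <:].

Lemma part_leq n (p : partition_of n) i : i \in parts p -> i <= n.
Proof.
case: p => s /= /and3P[_ _ /eqP <-]; elim: s => //= x s IHs.
rewrite inE => /predU1P[->|/IHs le_is]; first exact: leq_addr.
exact: leq_trans le_is (leq_addl _ _).
Qed.

Lemma size_parts_leq n (p : partition_of n) : size (parts p) <= n.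
Proof.
case: p => s /= /and3P[_ pos_s /eqP <-]; elim: s pos_s => //= x s IHs.
by case/andP=> x_gt0 /IHs le_s; rewrite -add1n leq_add.
Qed.

(* There are at most n parts, each at most n, so partition_of n embeds in the
   finite type of sequences of length at most n over 'I_n.+1. *)
Definition partition_code n (p : partition_of n) : n.-bseq 'I_n.+1 :=
  insub_bseq n (map inord (parts p)).

Definition partition_decode n (b : n.-bseq 'I_n.+1) : option (partition_of n) :=
  insub (map val b).

Lemma partition_codeK n : pcancel (@partition_code n) (@partition_decode n).
Proof.
move=> p; rewrite /partition_decode /partition_code /insub_bseq.
rewrite insubdK ?unfold_in ?size_map ?size_parts_leq //.
rewrite -map_comp (_ : map _ _ = parts p); first exact: valK.
rewrite -[RHS]map_id; apply/eq_in_map => i /part_leq le_in /=.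
by rewrite inordK.
Qed.

HB.instance Definition _ n : isFinite (partition_of n) :=
  PCanIsFinite (@partition_codeK n).

Definition mult (s : seq nat) (i : nat) : nat := count_mem i s.

Definition one_part_twice (s : seq nat) : bool :=
  has (fun i => (mult s i == 2) &&
                all (fun j => (j != i) ==> (mult s j == 1)) s) s.

Definition c2 (n : nat) : nat :=
  #|[set p : partition_of n | one_part_twice p]|.

Definition bomm (s : seq nat) (i : nat) : nat := (trunc_log 2 (mult s i)).+1.

Definition b2 (n : nat) : int :=
  ((\sum_(p : partition_of n | all odd p) \sum_(i <- undup p) bomm p i)%N%:Z
   - (\sum_(p : partition_of n | uniq p) size p)%N%:Z)%R.

(* Main.v *)
(* Both sides, increased by the total length of the partitions of n into
   distinct parts, count the pairs (j, nu) with 1 <= j <= n and nu a partition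
   of n - j into distinct parts. Adding j to nu yields a partition of n into
   distinct parts with the marked part j if j is not in nu, and one whose only
   repeated part is j, occurring twice, otherwise. On the odd side, the binary
   digits of m_i correspond to the k with 2^k <= m_i; removing 2^k copies of i
   leaves a partition of n - j into odd parts, where j = 2^k i determines
   (i, k), and Euler's theorem identifies the two counts. *)
Require Import Defs.
From HB Require Import structures.
From mathcomp Require Import all_boot all_order all_algebra.
From mathcomp Require Import zify.

Set Implicit Arguments.
Unset Strict Implicit.
Unset Printing Implicit Defensive.

(** * Comparing cardinalities along a relation *)

Lemma leq_card_rel (S T : finType) (A : pred S) (B : pred T)
    (R : S -> T -> Prop) :
    (forall x, A x -> exists2 y, B y & R x y) ->
    (forall x x' y, A x -> A x' -> B y -> R x y -> R x' y -> x = x') ->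
  #|A| <= #|B|.
Proof.
move=> exR injR.
(* The choice function takes values in [option T]: outside [A] no witness is given, and [T] may be
   empty. *)
have /fin_all_exists[f fP] (x : S) :
    exists o : option T, A x -> exists y, [/\ o = Some y, B y & R x y].
  case: (boolP (A x)) => [/exR[y By Rxy]|_]; last by exists None.
  by exists (Some y) => _; exists y.
have injf : {in A &, injective f}.
  move=> x x' Ax Ax' eqf; have [y [fx By Rxy]] := fP x Ax.
  have [y' [fx' By' Rxy']] := fP x' Ax'.
  move: eqf; rewrite fx fx' => -[eqy]; subst y'.
  exact: injR Rxy Rxy'.
have injSome : injective (@Some T) by move=> ? ? [].
rewrite -(card_in_image injf) -(card_image injSome).
apply: subset_leq_card; apply/subsetP => o /imageP[x Ax ->].
by have [y [-> By _]] := fP x Ax; apply: image_f.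
Qed.

(** Lets a bijection between partitions be given as a relation up to permutation or on
    multiplicities, with no explicit map on sorted sequences. *)
Lemma eq_card_rel (S T : finType) (A : pred S) (B : pred T)
    (R : S -> T -> Prop) :
    (forall x, A x -> exists2 y, B y & R x y) ->
    (forall y, B y -> exists2 x, A x & R x y) ->
    (forall x x' y, A x -> A x' -> B y -> R x y -> R x' y -> x = x') ->
    (forall x y y', A x -> B y -> B y' -> R x y -> R x y' -> y = y') ->
  #|A| = #|B|.
Proof.
move=> exR exR' injR injR'; apply/eqP; rewrite eqn_leq.
rewrite (leq_card_rel exR injR) /=.
apply: (leq_card_rel (R := fun y x => R x y)) => // y y' x *.
by apply: injR'; eauto.
Qed.

(** * Partitions and their multiplicity functions *)

Lemma geq_trans : transitive geq.
Proof. by move=> y x z /= hxy hyz; apply: leq_trans hyz hxy. Qed.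

Lemma perm_is_partition n (p : partition_of n) (s : seq nat) :
  is_partition n s -> perm_eq p s -> parts p = s.
Proof.
move=> /and3P[s_sort _ _] eqps; have /and3P[p_sort _ _] := partsP p.
apply: (sorted_eq geq_trans) => // x y.
by rewrite /= andbC => /anti_leq.
Qed.

Lemma perm_partition n (p q : partition_of n) : perm_eq p q -> p = q.
Proof.
by move=> eqpq; apply/val_inj; apply: perm_is_partition eqpq; apply: partsP.
Qed.

Lemma partition_exists n (s : seq nat) :
  all (leq 1) s -> sumn s = n -> exists p : partition_of n, perm_eq p s.
Proof.
move=> s_pos s_sum.
have s_part : is_partition n (sort geq s).
  rewrite /is_partition sort_sorted; last by move=> x y; apply: leq_total.
  by rewrite all_sort s_pos (perm_sumn (permEl (perm_sort geq s))) s_sum eqxx.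
by exists (PartitionOf s_part); rewrite perm_sort.
Qed.

Lemma part_gt0 n (p : partition_of n) i : i \in parts p -> 0 < i.
Proof. by have /and3P[_ /allP p_pos _] := partsP p => /p_pos. Qed.

Lemma mult_gt0 s i : (0 < mult s i) = (i \in s).
Proof. by rewrite -has_pred1 has_count. Qed.

Lemma mult_notin s i : i \notin s -> mult s i = 0.
Proof. by rewrite -mult_gt0 -eqn0Ngt => /eqP. Qed.

Lemma mult_oob n (p : partition_of n) i : ~~ (0 < i <= n) -> mult p i = 0.
Proof.
apply: contraNeq; rewrite -lt0n mult_gt0 => ip.
by rewrite (part_gt0 ip) (part_leq ip).
Qed.

Lemma sumn_mult n s : all (fun i => 0 < i <= n) s ->
  sumn s = \sum_(1 <= j < n.+1) j * mult s j.
Proof.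
elim: s => [_|x s IHs /= /andP[xn /IHs ->]].
  by rewrite big1 // => j _; rewrite muln0.
under [RHS]eq_bigr do rewrite mulnDr.
rewrite big_split /=; congr (_ + _).
rewrite (bigD1_seq x) ?iota_uniq ?mem_index_iota //= eqxx muln1.
by rewrite big1 ?addn0 // => j /negPf; rewrite eq_sym => ->; rewrite muln0.
Qed.

Lemma partition_sumn_mult n (p : partition_of n) :
  \sum_(1 <= j < n.+1) j * mult p j = n.
Proof.
rewrite -sumn_mult; first by have /and3P[_ _ /eqP] := partsP p.
by apply/allP => i ip; rewrite (part_gt0 ip) (part_leq ip).
Qed.

Lemma mult_muln_leq n (p : partition_of n) i : mult p i * i <= n.
Proof.
case: (boolP (0 < i <= n)) => [iN|/mult_oob->//].
rewrite -[leqRHS](partition_sumn_mult p).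
by rewrite (bigD1_seq i) ?iota_uniq ?mem_index_iota //= mulnC leq_addr.
Qed.

(** Concatenate [m j] copies of each j from 1 to n. The vanishing of [m] elsewhere makes the
    multiplicities agree at every j. *)
Lemma partition_of_mult n (m : nat -> nat) :
    (forall j, ~~ (0 < j <= n) -> m j = 0) ->
    \sum_(1 <= j < n.+1) j * m j = n ->
  exists p : partition_of n, forall j, mult p j = m j.
Proof.
move=> m_oob m_sum.
pose s := flatten [seq nseq (m j) j | j <- index_iota 1 n.+1].
have s_mult j : mult s j = m j.
  rewrite /mult /s count_flatten -map_comp sumnE big_map.
  under eq_bigr do rewrite /= count_nseq /=.
  case: (boolP (0 < j <= n)) => [jn|jn].
    rewrite (bigD1_seq j) ?iota_uniq ?mem_index_iota //= eqxx mul1n.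
    by rewrite big1 ?addn0 // => i /negPf ->.
  rewrite m_oob // big_seq big1 // => i.
  by rewrite mem_index_iota ltnS; case: eqP => // ->; rewrite (negPf jn).
have s_bd : all (fun i => 0 < i <= n) s.
  apply/allP => i; rewrite -mult_gt0 s_mult; apply: contraTT => /m_oob ->.
  by [].
have s_pos : all (leq 1) s by apply: sub_all s_bd => i /andP[].
have s_sum : sumn s = n.
  rewrite (sumn_mult s_bd) -[RHS]m_sum.
  by apply: eq_bigr => j _; rewrite s_mult.
have [p eqps] := partition_exists s_pos s_sum.
by exists p => j; rewrite -s_mult; apply/permP.
Qed.

Lemma eq_partition_mult n (p q : partition_of n) :
  (forall j, 0 < j <= n -> mult p j = mult q j) -> p = q.
Proof.
move=> eqpq; apply: perm_partition; apply/allP => /= j _; apply/eqP.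
change (mult p j = mult q j).
by case: (boolP (0 < j <= n)) => [/eqpq//|jn]; rewrite !mult_oob.
Qed.

(** Inserting t copies of i is injective. It can be undone on [B], whose members contain at least t
    copies of i. *)
Lemma card_add_part n i t (A : pred (partition_of (n - t * i)))
    (B : pred (partition_of n)) : 0 < i -> t * i <= n ->
    (forall q, B q -> t <= mult q i) ->
    (forall (p : partition_of (n - t * i)) (q : partition_of n),
       perm_eq q (nseq t i ++ p) -> A p = B q) ->
  #|A| = #|B|.
Proof.
move=> i_gt0 tin Bt AB.
have sum_nseq : sumn (nseq t i) = t * i by rewrite sumn_nseq mulnC.
apply: (eq_card_rel (R := fun (p : partition_of _) (q : partition_of n) =>
  perm_eq q (nseq t i ++ p))).
- move=> p Ap; have /and3P[_ p_pos /eqP p_sum] := partsP p.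
  have [|| q eqq] := @partition_exists n (nseq t i ++ p).
  + by rewrite all_cat p_pos andbT all_nseq i_gt0 orbT.
  + by rewrite sumn_cat p_sum sum_nseq subnKC.
  by exists q => //; rewrite -(AB _ _ eqq).
- move=> q Bq; have /and3P[_ q_pos /eqP q_sum] := partsP q.
  (* [s] is [q] with t copies of i removed; its order is irrelevant. *)
  pose s := nseq (mult q i - t) i ++ [seq j <- q | j != i].
  have eqs : perm_eq q (nseq t i ++ s).
    have eqf := all_pred1P _ _ (filter_all (pred1 i) q).
    rewrite size_filter in eqf.
    rewrite catA -nseqD subnKC ?Bt // perm_sym /mult -eqf.
    exact: permEl (perm_filterC (pred1 i) q).
  have [|| p eqp] := @partition_exists (n - t * i) s.
  + by move: q_pos; rewrite (perm_all _ eqs) all_cat => /andP[].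
  + by rewrite -q_sum (perm_sumn eqs) sumn_cat sum_nseq addKn.
  have eqq : perm_eq q (nseq t i ++ p).
    by rewrite (perm_trans eqs) // perm_cat2l perm_sym.
  by exists p => //; rewrite (AB _ _ eqq).
- move=> p p' q _ _ _ eqp eqp'; apply: perm_partition.
  by rewrite -(perm_cat2l (nseq t i)) -(permPl eqp).
- move=> p q q' _ _ _ eqq eqq'; apply: perm_partition.
  by rewrite (permPl eqq) perm_sym.
Qed.

(** * Odd parts of integers and binary digits *)

Lemma dyadic_decomposition j : 0 < j -> exists k i, odd i /\ j = 2 ^ k * i.
Proof.
move=> j_gt0; have [i] := pfactor_coprime (isT : prime 2) j_gt0.
by rewrite coprime2n mulnC => oi eqj; exists (logn 2 j), i.
Qed.

Lemma logn_dyadic k i : odd i -> logn 2 (2 ^ k * i) = k.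
Proof.
move=> oi; rewrite lognM ?expn_gt0 ?(odd_gt0 oi) // pfactorK //.
by rewrite lognE /= dvdn2 oi /= andbF addn0.
Qed.

(** As k < 2^k, both k and i are at most 2^k i, so they can be indexed by ['I_n.+1]. *)
Lemma dyadic_leq_exp k i n : odd i -> 2 ^ k * i <= n -> k < n.+1 /\ i < n.+1.
Proof.
move=> oi kin; split; rewrite ltnS; apply: leq_trans kin.
  by apply: leq_trans (leq_pmulr _ (odd_gt0 oi)); apply/ltnW/ltn_expl.
by rewrite leq_pmull ?expn_gt0.
Qed.

(** Reindexes by the unique writing j = 2^k i with i odd. *)
Lemma sum_dyadic n (F : nat -> nat) :
  \sum_(1 <= j < n.+1) F j =
  \sum_(1 <= i < n.+1 | odd i) \sum_(k < n.+1 | 2 ^ k * i <= n) F (2 ^ k * i).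
Proof.
rewrite !big_geq_mkord /=.
rewrite pair_big_dep /=.
(* [inord] sends values above n to 0, so the condition 0 < j discards the pairs with 2^k i > n. *)
pose h (p : 'I_n.+1 * 'I_n.+1) : 'I_n.+1 := inord (2 ^ p.2 * p.1).
pose h' (j : 'I_n.+1) : 'I_n.+1 * 'I_n.+1 :=
  (inord (j %/ 2 ^ logn 2 j), inord (logn 2 j)).
have hK (j : 'I_n.+1) : 0 < j -> h (h' j) = j.
  case: j => j /= jn j_gt0; have [k [i [oi eqj]]] := dyadic_decomposition j_gt0.
  apply: val_inj; rewrite /h /h' /= eqj logn_dyadic // mulKn ?expn_gt0 //.
  have [kn iN] : k < n.+1 /\ i < n.+1.
    by apply: dyadic_leq_exp => //; rewrite -eqj.
  by rewrite !inordK // -eqj.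
rewrite (reindex_onto h h') //=.
have hE (i k : 'I_n.+1) : 2 ^ k * i <= n -> h (i, k) = 2 ^ k * i :> nat.
  by move=> kin; rewrite /h /= inordK.
apply: eq_big => [[i k]|[i k] /=] /=.
  case: (leqP (2 ^ k * i) n) => kin; last first.
    rewrite andbF /h /inord /insubd insubF //.
    by apply/negbTE; rewrite -leqNgt.
  rewrite hE // andbT muln_gt0 expn_gt0 /=.
  apply/andP/andP => -[]; last first.
    move=> oi i_gt0; split=> //; rewrite /h' hE //.
    rewrite logn_dyadic // mulKn ?expn_gt0 //.
    by apply/eqP; congr (_, _); apply: val_inj; rewrite /= inordK.
  (* Since [h'] returns the odd part in its first component, recovering (i, k) forces i to be
     odd. *)
  move=> i_gt0 /eqP hik; split=> //.
  have j_gt0 : 0 < 2 ^ k * i by rewrite muln_gt0 expn_gt0.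
  have [k' [i' [oi' eqj]]] := dyadic_decomposition j_gt0.
  move/(congr1 fst): hik; rewrite /h' /= hE // eqj logn_dyadic //.
  rewrite mulKn ?expn_gt0 //.
  have [_ i'n] : k' < n.+1 /\ i' < n.+1.
    by apply: dyadic_leq_exp => //; rewrite -eqj.
  by move/(congr1 val); rewrite /= inordK // => <-.
case: (leqP (2 ^ k * i) n) => kin; first by rewrite hE.
by rewrite /h /inord /insubd insubF //; apply/negbTE; rewrite -leqNgt.
Qed.

Lemma sum_bits K m : m < 2 ^ K -> \sum_(k < K) 2 ^ k * odd (m %/ 2 ^ k) = m.
Proof.
elim: K m => [|K IHK] m; first by rewrite expn0 big_ord0; case: m.
rewrite expnS mul2n => ltm.
rewrite big_ord_recl expn0 mul1n divn1 -[RHS](odd_double_half m); congr (_ + _).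
rewrite -[in RHS](IHK m./2) -?mul2n ?big_distrr /=; last by lia.
by apply: eq_bigr => k _; rewrite /bump /= add1n expnS -mulnA divnMA divn2.
Qed.

(** The parity of the sum gives the digit at 0; cancelling it and halving leaves the shifted
    digits. *)
Lemma bits_inj K (b c : nat -> nat) :
    (forall k, b k <= 1) -> (forall k, c k <= 1) ->
    \sum_(k < K) 2 ^ k * b k = \sum_(k < K) 2 ^ k * c k ->
  forall k, k < K -> b k = c k.
Proof.
elim: K b c => [|K IHK] b c b1 c1 //.
have split0 (d : nat -> nat) : \sum_(k < K.+1) 2 ^ k * d k =
    d 0 + 2 * \sum_(k < K) 2 ^ k * d k.+1.
  rewrite big_ord_recl expn0 mul1n big_distrr /=; congr (_ + _).
  by apply: eq_bigr => k _; rewrite /bump /= add1n expnS mulnA.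
rewrite !split0 => eq_bc.
have b0 := b1 0; have c0 := c1 0.
case=> [_|k kK]; first by lia.
have eq0 : b 0 = c 0 by lia.
apply: (IHK (b \o succn) (c \o succn)) => //=.
by move/eqP: eq_bc; rewrite eq0 eqn_add2l eqn_pmul2l // => /eqP.
Qed.

Lemma uniq_mult s : uniq s <-> forall i, mult s i <= 1.
Proof.
split=> [us i|us]; first by rewrite /mult count_uniq_mem // leq_b1.
apply: count_mem_uniq => i; have := us i; rewrite -[i \in s]mult_gt0 /mult.
by case: count => [|[]].
Qed.

(** * Euler's theorem on odd and distinct parts *)

Definition distinct_count n := #|[pred p : partition_of n | uniq p]|.
Definition odd_count n := #|[pred p : partition_of n | all odd p]|.

(* Glaisher's bijection: the binary digits of the multiplicity of an odd part i
   tell which of the parts 2^k i occur in the distinct partition. *)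
Lemma euler_odd_distinct n : distinct_count n = odd_count n.
Proof.
pose R (p q : partition_of n) := forall i, odd i ->
  mult q i = \sum_(k < n.+1) 2 ^ k * mult p (2 ^ k * i).
have sum_trim (m : nat -> nat) i : (forall j, ~~ (0 < j <= n) -> m j = 0) ->
    \sum_(k < n.+1) 2 ^ k * m (2 ^ k * i) =
    \sum_(k < n.+1 | 2 ^ k * i <= n) 2 ^ k * m (2 ^ k * i).
  move=> m_oob; rewrite [RHS]big_mkcond; apply: eq_bigr => k _.
  by case: ifPn => // kin; rewrite m_oob ?muln0 // negb_and kin orbT.
(* Merging each part 2^k i into 2^k copies of i preserves the total: group the j by their odd part
   i. *)
have sumR (m m' : nat -> nat) : (forall j, ~~ (0 < j <= n) -> m j = 0) ->
    (forall i,
      m' i = if odd i then \sum_(k < n.+1) 2 ^ k * m (2 ^ k * i) else 0) ->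
    \sum_(1 <= j < n.+1) j * m' j = \sum_(1 <= j < n.+1) j * m j.
  move=> m_oob m'E; rewrite [RHS]sum_dyadic [RHS]big_mkcond.
  apply: eq_bigr => i _; rewrite m'E; case: ifP => // _; last by rewrite muln0.
  rewrite sum_trim // big_distrr /=; apply: eq_bigr => k _.
  by rewrite mulnA [i * _]mulnC.
have mult_even (q : partition_of n) i : all odd q -> ~~ odd i -> mult q i = 0.
  by move=> /allP oq; move/(contra (oq i))/mult_notin.
apply: (eq_card_rel (R := R)).
- move=> p up.
  pose m i := if odd i then \sum_(k < n.+1) 2 ^ k * mult p (2 ^ k * i) else 0.
  have [j jn | | q qm] := @partition_of_mult n m.
  + rewrite /m; case: ifP => // oj; rewrite big1 // => k _.
    move: jn; rewrite (odd_gt0 oj) /= -ltnNge => ltnj.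
    rewrite mult_oob ?muln0 // negb_and -!ltnNge (leq_trans ltnj) ?orbT //.
    by rewrite leq_pmull ?expn_gt0.
  + rewrite (@sumR (mult p)) //; last by move=> j /mult_oob.
    exact: partition_sumn_mult.
  exists q; last by move=> i oi; rewrite qm /m oi.
  apply/allP => i; rewrite -mult_gt0 qm /m; by case: odd.
- move=> q oq.
  (* For j = 2^k i with i odd, this is the k-th binary digit of the multiplicity of i in [q]. *)
  pose m j := odd (mult q (j %/ 2 ^ logn 2 j) %/ 2 ^ logn 2 j) : nat.
  have mE k i : odd i -> m (2 ^ k * i) = odd (mult q i %/ 2 ^ k).
    by move=> oi; rewrite /m logn_dyadic // mulKn ?expn_gt0.
  have m_oob j : ~~ (0 < j <= n) -> m j = 0.
    case: (posnP j) => [-> _|j_gt0]; first by rewrite /m div0n mult_oob ?div0n.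
    have [k [i [oi ->]]] := dyadic_decomposition j_gt0.
    rewrite /= -ltnNge => ltn_ki.
    rewrite mE // divn_small // -(ltn_pmul2r (odd_gt0 oi)).
    exact: leq_ltn_trans (mult_muln_leq q i) ltn_ki.
  have qE i :
      mult q i = if odd i then \sum_(k < n.+1) 2 ^ k * m (2 ^ k * i) else 0.
    case: ifPn => [oi|/mult_even->//].
    (* A multiplicity is at most n < 2^(n+1), so n+1 digits suffice. *)
    rewrite -[LHS](@sum_bits n.+1); first by apply: eq_bigr => k _; rewrite mE.
    apply: leq_ltn_trans (ltn_expl n.+1 (ltnSn 1)).
    apply: leq_trans (leqnSn n).
    exact: leq_trans (count_size _ _) (size_parts_leq q).
  have [|p pm] := partition_of_mult m_oob.
    by rewrite -(sumR _ _ m_oob qE) partition_sumn_mult.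
  exists p; first by apply/uniq_mult => j; rewrite pm leq_b1.
  move=> i oi; rewrite qE oi; apply: eq_bigr => k _; by rewrite pm.
- move=> p p' q up up' oq Rp Rp'; apply: eq_partition_mult => j /andP[j0 jn].
  have [k [i oi ->] kn] :
      exists2 k, (exists2 i, odd i & j = 2 ^ k * i) & k < n.+1.
    have [k [i [oi eqj]]] := dyadic_decomposition j0.
    exists k; first by exists i.
    by rewrite eqj in jn; have [] := dyadic_leq_exp oi jn.
  move/uniq_mult in up; move/uniq_mult in up'.
  apply: (bits_inj (b := fun k => mult p (2 ^ k * i))
    (c := fun k => mult p' (2 ^ k * i))) kn => //.
  by rewrite -Rp // -Rp'.
- move=> p q q' up oq oq' Rq Rq'; apply: eq_partition_mult => i _.
  by case: (boolP (odd i)) => oi; [rewrite Rq // Rq' | rewrite !mult_even].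
Qed.

(** * Double counting of marked partitions *)

Lemma sum_card (T : finType) n (P : T -> nat -> bool) :
  \sum_(1 <= j < n.+1) #|[pred x | P x j]| =
  \sum_(x : T) \sum_(1 <= j < n.+1) P x j.
Proof.
rewrite exchange_big /=; apply: eq_bigr => j _.
rewrite -sum1_card big_mkcond /=; apply: eq_bigr => x _.
by case: ifP; rewrite inE => ->.
Qed.

Lemma odd_marked_count n :
  \sum_(p : partition_of n | all odd p) \sum_(i <- undup p) bomm p i =
  \sum_(1 <= j < n.+1) odd_count (n - j).
Proof.
rewrite sum_dyadic.
have -> : \sum_(1 <= i < n.+1 | odd i)
      \sum_(k < n.+1 | 2 ^ k * i <= n) odd_count (n - 2 ^ k * i) =
    \sum_(1 <= i < n.+1 | odd i) \sum_(k < n.+1)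
      \sum_(p : partition_of n | all odd p) (2 ^ k <= mult p i).
  apply: eq_bigr => i oi; rewrite [LHS]big_mkcond /=; apply: eq_bigr => k _.
  rewrite -big_mkcondr /= sum1_card.
  (* If 2^k i > n, no partition of n has 2^k copies of i; otherwise these copies can be removed. *)
  case: leqP => [kin|lt_ki]; last first.
    rewrite eq_card0 // => p; rewrite inE; apply/negbTE/negP => /andP[_ le_k].
    move: lt_ki; rewrite ltnNge; apply/negP/negPn.
    by apply: leq_trans (mult_muln_leq p i); rewrite leq_mul2r le_k orbT.
  apply: (@card_add_part n i) => //=; first exact: odd_gt0.
    by move=> q; rewrite /= => /andP[].
  move=> p q eqq; rewrite /= (perm_all _ eqq) all_cat all_nseq oi orbT /=.
  move/permP: eqq => /(_ (pred1 i)).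
  rewrite /mult count_cat count_nseq /= eqxx mul1n => ->.
  by rewrite leq_addr andbT.
under eq_bigr do rewrite exchange_big.
rewrite exchange_big /=; apply: eq_bigr => p op.
have -> : \sum_(i <- undup p) bomm p i =
    \sum_(i <- index_iota 1 n.+1 | i \in undup p) bomm p i.
  rewrite -[RHS]big_filter; apply: perm_big; apply: uniq_perm.
  - exact: undup_uniq.
  - by rewrite filter_uniq ?iota_uniq.
  move=> i; rewrite mem_filter mem_index_iota mem_undup.
  case: (boolP (i \in parts p)) => //= ip.
  by rewrite (part_gt0 ip) ltnS (part_leq ip).
rewrite big_mkcond [RHS]big_mkcond; apply: eq_bigr => i _ /=.
rewrite mem_undup -mult_gt0.
case: posnP => [m0|m_gt0].
  rewrite m0; case: odd => //; rewrite big1 // => k _.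
  by rewrite leqNgt expn_gt0.
have -> : odd i by move/allP: op; apply; rewrite -mult_gt0.
(* The range k <= n covers all digits, since 2^([trunc_log]) is at most the multiplicity, hence at
   most n <= 2^n. *)
have lt_t : (trunc_log 2 (mult p i)).+1 <= n.+1.
  rewrite ltnS -(leq_exp2l _ _ (ltnSn 1)).
  apply: leq_trans (trunc_logP _ m_gt0) _ => //.
  apply: leq_trans (ltnW (ltn_expl n (ltnSn 1))).
  exact: leq_trans (count_size _ _) (size_parts_leq p).
rewrite -big_mkcond /= (eq_bigl (fun k : 'I_n.+1 => k < bomm p i)).
  by rewrite (big_ord_narrow lt_t) sum1_card card_ord.
move=> k; rewrite /bomm ltnS; apply/idP/idP => [|le_k].
  exact: trunc_log_max.
by apply: leq_trans (trunc_logP (ltnSn 1) m_gt0); rewrite leq_exp2l.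
Qed.

(** This is [one_part_twice] with the repeated part as an argument, so that it can serve as the
    mark. *)
Definition twice_at (s : seq nat) (i : nat) : bool :=
  (mult s i == 2) && all (fun j => (j != i) ==> (mult s j == 1)) s.

Lemma distinct_count_split n j : 0 < j <= n ->
  distinct_count (n - j) =
  #|[pred p : partition_of n | uniq p && (j \in parts p)]| +
  #|[pred p : partition_of n | twice_at p j]|.
Proof.
case/andP=> j_gt0 jn.
rewrite /distinct_count.
(* If j is absent, adding it keeps the parts distinct; if it is present, it becomes the doubled
   part. *)
rewrite -(cardID [pred p : partition_of (n - j) | j \notin parts p]).
have cons_mult m (p : partition_of m) (q : partition_of n) :
    perm_eq q (nseq 1 j ++ p) -> forall i, mult q i = (j == i) + mult p i.
  by move=> /permP eqq i; rewrite /mult eqq.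
have n1j : n - j = n - 1 * j by rewrite mul1n.
rewrite n1j; congr (_ + _).
  apply: (@card_add_part n j 1); rewrite ?mul1n //.
    by move=> q /= /andP[_]; rewrite mult_gt0.
  move=> p q eqq /=; rewrite !inE /= (perm_uniq eqq) (perm_mem eqq) /=.
  by rewrite inE eqxx andbT andbC.
apply: (@card_add_part n j 1); rewrite ?mul1n //.
  by move=> q /= /andP[/eqP->].
move=> p q eqq; rewrite !inE /= negbK /twice_at.
have qE := cons_mult _ _ _ eqq.
(* Away from j, the multiplicities in [q] and [p] coincide. *)
rewrite (eq_all (a2 := fun i => (i != j) ==> (mult p i == 1))); last first.
  by move=> i; rewrite /= qE eq_sym; case: eqVneq.
rewrite (perm_all _ eqq) /= eqxx /= qE eqxx add1n eqSS.
apply/andP/andP => [[jp /uniq_mult up]|[/eqP jp /allP up]].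
  split; first by rewrite eqn_leq up mult_gt0.
  by apply/allP => i ip; rewrite [mult p i == 1]eqn_leq up mult_gt0 ip implybT.
split; first by rewrite -mult_gt0 jp.
apply/uniq_mult => i; case: (boolP (i \in parts p)) => [/up|/mult_notin->//].
by case: eqVneq => [->|_ /= /eqP->//]; rewrite jp.
Qed.

Lemma distinct_marked_count n :
  \sum_(1 <= j < n.+1) distinct_count (n - j) =
  \sum_(p : partition_of n | uniq p) size p + c2 n.
Proof.
rewrite big_nat (eq_bigr _ (fun j => @distinct_count_split n j)) -big_nat.
rewrite big_split /= !sum_card; congr (_ + _).
  rewrite [RHS]big_mkcond; apply: eq_bigr => p _ /=.
  case: ifP => up; last by rewrite big1.
  rewrite -big_mkcond /= sum1_count -size_filter.
  apply/perm_size/uniq_perm => //.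
    by rewrite filter_uniq ?iota_uniq.
  move=> i; rewrite mem_filter mem_index_iota.
  case: (boolP (i \in parts p)) => //= ip.
  by rewrite (part_gt0 ip) ltnS (part_leq ip).
rewrite /c2 -sum1_card [RHS]big_mkcond; apply: eq_bigr => p _ /=.
rewrite inE /one_part_twice; case: hasP => [[i ip /andP[pi /allP pi']]|no].
  have iN : 0 < i <= n by rewrite (part_gt0 ip) (part_leq ip).
  (* Only j = i contributes: every other part occurs once, so the repeated part is unique. *)
  rewrite (bigD1_seq i) ?iota_uniq ?mem_index_iota //=.
  rewrite {1}/twice_at pi (introT allP pi') big1 // => j ji.
  rewrite /twice_at; case: eqP => //= pj.
  have /pi' : j \in parts p by rewrite -mult_gt0 pj.
  by rewrite ji pj.
rewrite big1 // => j _; case: (boolP (twice_at p j)) => // pj.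
case: no; exists j => //; rewrite -mult_gt0.
by case/andP: pj => /eqP->.
Qed.

Theorem mainTheorem7 (n : nat) (hn : 1 <= n) : (c2 n)%:Z%R = b2 n.
Proof.
rewrite /b2 odd_marked_count.
(* Euler's theorem is applied to each n - j; the total length then cancels. *)
under [in RHS]eq_bigr do rewrite -euler_odd_distinct.
by rewrite distinct_marked_count PoszD GRing.addrC GRing.addKr.
Qed.
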